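(* Let $\mathcal{H}$ be a finite-dimensional real Hilbert space, $\mathcal{S}\subseteq\mathscr{B}(\mathcal{H})$ an irreducible self-adjoint family of operators, and $W_1,W_2\in\mathscr{B}(\mathcal{H})$ such that $\sum_{j=1}^2W_j^*ZW_j=Z$ for all $Z\in\mathcal{S}$ and $\sum_{j=1}^2W_j^*W_j=I$. Then $W_jZ=ZW_j$ for $j=1,2$ and all $Z\in C^*(\mathcal{S})$, the (real) $C^*$-algebra generated by $\mathcal{S}$.
   Context: $\mathscr{B}(\mathcal{H})$ is the algebra of (real linear) operators on $\mathcal{H}$. A family $\mathcal{S}\subseteq\mathscr{B}(\mathcal{H})$ is self-adjoint if $\mathcal{S}=\mathcal{S}^*:=\{Z^*:Z\in\mathcal{S}\}$, and irreducible if the only closed subspaces of $\mathcal{H}$ invariant under all elements of $\mathcal{S}$ are $\{0\}$ and $\mathcal{H}$. *)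

(* Defs.v *)
From HB Require Import structures.
From mathcomp Require Import all_boot all_order all_algebra.
From mathcomp Require Import boolp classical_sets reals.
From mathcomp Require Import ring lra.

Set Implicit Arguments.
Unset Strict Implicit.
Unset Printing Implicit Defensive.

Import Order.TTheory GRing.Theory Num.Theory.

Local Open Scope classical_set_scope.
Local Open Scope ring_scope.

(* A finite-dimensional real Hilbert space is a [vectType] H over the reals
   together with a positive definite symmetric form [dot : {dot H for idfun}];
   completeness is automatic. 'End(H) is the algebra of linear operators on H. *)

Section Operators.
Variables (R : realType) (H : vectType R) (dot : {dot H for idfun}).
Implicit Types (T U : 'End(H)) (S A : set 'End(H)).

Definition hnorm (x : H) : R := Num.sqrt (dot x x).

(* The supremum is that of a nonempty bounded set: see [opnorm_has_sup]. *)
Definition opnorm T : R := sup [set hnorm (T x) | x in [set x | hnorm x <= 1]].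

(* Existence and uniqueness are [adjointP] and [adjoint_unique]; the default
   value 0 is never used. *)
Definition adjoint T : 'End(H) :=
  xget 0 [set T' : 'End(H) | forall x y, dot (T x) y = dot x (T' y)].

Definition selfadjoint_family S : Prop := S = [set adjoint Z | Z in S].

(* In finite dimension every linear subspace is closed, so that the closed
   subspaces of H are exactly the U : {vspace H}. *)
Definition irreducible_family S : Prop :=
  forall U : {vspace H}, (forall Z, S Z -> (Z @: U <= U)%VS) ->
    U = 0%VS \/ U = fullv.

Definition norm_closed A : Prop :=
  forall T, (forall e : R, 0 < e -> exists2 U, A U & opnorm (T - U) < e) -> A T.

(* Concrete real C*-algebras of operators on H, not required to contain the
   identity operator. *)
Record is_real_Cstar_algebra A : Prop := {
  Cstar_0 : A 0 ;
  Cstar_lin : forall (a : R) T U, A T -> A U -> A (a *: T + U) ;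
  Cstar_mul : forall T U, A T -> A U -> A (T \o U)%VF ;
  Cstar_adj : forall T, A T -> A (adjoint T) ;
  Cstar_closed : norm_closed A }.

Definition Cstar S : set 'End(H) := smallest is_real_Cstar_algebra S.

Lemma dot_sym x y : dot x y = dot y x.
Proof. by rewrite hermC expr0 mul1r. Qed.

Lemma dot_gt0 x : x != 0 -> 0 < dot x x.
Proof. exact: neq0_dnorm_gt0. Qed.

Lemma dot_ge0 x : 0 <= dot x x.
Proof. by have [->|/dot_gt0/ltW//] := eqVneq x 0; rewrite linear0l. Qed.

Lemma dot_eq0 x : dot x x = 0 -> x = 0.
Proof.
by move=> x0; apply/eqP; apply: contraT => /dot_gt0; rewrite x0 ltxx.
Qed.

Lemma dot_inj x y : (forall z, dot z x = dot z y) -> x = y.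
Proof.
move=> h; apply/eqP; rewrite -subr_eq0; apply/eqP/dot_eq0.
by rewrite linearBr /= h subrr.
Qed.

Lemma riesz (f : H -> R) :
  (forall a x y, f (a *: x + y) = a * f x + f y) ->
  exists z, forall x, f x = dot x z.
Proof.
move=> flin.
have f0 : f 0 = 0 by have := flin 1 0 0; rewrite scaler0 addr0; lra.
pose b := vbasis (@fullv _ H); pose n := \dim (@fullv _ H).
have bE (x : H) : x = \sum_(i < n) coord b i x *: b`_i.
  by apply: coord_vbasis; rewrite memvf.
have fsum (c : 'I_n -> R) (v : 'I_n -> H) :
    f (\sum_(i < n) c i *: v i) = \sum_(i < n) c i * f (v i).
  by elim/big_rec2: _ => // i y1 y2 _ <-; rewrite flin.
pose g (y : H) := \sum_(i < n) dot b`_i y *: b`_i.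
have g_lin : linear g.
  move=> a x y; rewrite /g scaler_sumr -big_split; apply: eq_bigr => i _ /=.
  by rewrite linearPr /= scalerDl scalerA.
pose g' : {linear H -> H} :=
  HB.pack g (GRing.isLinear.Build R H H *:%R g g_lin).
pose G := linfun g'.
have b_free : free b by have /andP[] := vbasisP (@fullv _ H).
have kerG : lker G == 0%VS.
  apply/lker0P => x y; rewrite !lfunE /= => gxy.
  apply: dot_inj => z; rewrite (bE z).
  rewrite !linear_sumlz; apply: eq_bigr => i _.
  rewrite !linearZl_LR /=; congr (_ * _).
  by have /freeP := b_free => /(_ (fun i => dot b`_i x - dot b`_i y)) bf;
    apply/eqP; rewrite -subr_eq0; apply/eqP/bf;
    under eq_bigr do rewrite scalerBl; rewrite big_split /= sumrN;
    apply/eqP; rewrite subr_eq0; apply/eqP.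
pose t := \sum_(i < n) f b`_i *: b`_i.
have gz : g ((G^-1)%VF t) = t.
  by have := congr1 (fun F : 'End(H) => F t) (lker0_compfV kerG);
    rewrite comp_lfunE id_lfunE lfunE.
exists ((G^-1)%VF t) => x; set z := (G^-1)%VF t in gz *.
rewrite (bE x) fsum linear_sumlz; apply: eq_bigr => i _.
rewrite linearZl_LR /=; congr (_ * _).
have /freeP := b_free => /(_ (fun i => f b`_i - dot b`_i z)) bf.
apply/eqP; rewrite -subr_eq0; apply/eqP/bf.
under eq_bigr do rewrite scalerBl.
by rewrite big_split /= sumrN -/(g z) gz subrr.
Qed.

Lemma adjointP T x y : dot (T x) y = dot x (adjoint T y).
Proof.
suff [T' T'E] : exists T' : 'End(H), forall x y, dot (T x) y = dot x (T' y).
  exact: (xgetPex (0 : 'End(H))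
    (P := [set T' : 'End(H) | forall x y, dot (T x) y = dot x (T' y)])
    (ex_intro _ T' T'E)).
have /boolp.choice [h hE] :
    forall y, exists z, forall x, dot (T x) y = dot x z.
  move=> {}y; apply: (@riesz (fun x => dot (T x) y)) => a u v.
  by rewrite linearP linearPl.
have h_lin : linear h.
  by move=> a u v; apply: dot_inj => z; rewrite -hE !linearPr /= !hE.
pose h' : {linear H -> H} :=
  HB.pack h (GRing.isLinear.Build R H H *:%R h h_lin).
by exists (linfun h') => u v; rewrite lfunE /= hE.
Qed.

Lemma adjoint_unique T T' :
  (forall x y, dot (T x) y = dot x (T' y)) -> T' = adjoint T.
Proof.
move=> h; apply/lfunP => y; apply: dot_inj => x; by rewrite -h adjointP.
Qed.

Lemma dot_CauchySchwarz x y : `|dot x y| <= hnorm x * hnorm y.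
Proof.
have [->|y0] := eqVneq y 0.
  by rewrite linear0r normr0 mulr_ge0 ?sqrtr_ge0.
have yy := dot_gt0 y0.
rewrite /hnorm -sqrtrM ?dot_ge0// -sqrtr_sqr ler_sqrt ?mulr_ge0 ?dot_ge0//.
have := dot_ge0 (dot y y *: x - dot x y *: y).
rewrite linearBl !linearBr !linearZl_LR !linearZr_LR /= (dot_sym y x).
set a := dot x x; set c := dot x y; set d := dot y y => h.
have : 0 <= d * (a * d - c ^+ 2).
  by rewrite (le_trans h)// le_eqVlt; apply/orP; left; apply/eqP; ring.
by rewrite pmulr_rge0 // subr_ge0.
Qed.

Lemma opnorm_has_sup T :
  has_sup [set hnorm (T x) | x in [set x | hnorm x <= 1]].
Proof.
split.
  by exists (hnorm (T 0)), 0 => //=; rewrite /hnorm linear0l sqrtr0 ler01.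
pose b := vbasis (@fullv _ H); pose n := \dim (@fullv _ H).
have /boolp.choice [z zE] : forall i, exists z, forall x, coord b i x = dot x z.
  by move=> i; apply: riesz => a x y; rewrite linearP.
pose B := (adjoint T \o T)%VF.
exists (Num.sqrt (\sum_(i < n) hnorm (z i) * hnorm (B b`_i))).
move=> _ [x /= x1 <-]; rewrite ler_sqrt; last first.
  by apply: sumr_ge0 => i _; rewrite mulr_ge0 ?sqrtr_ge0.
have le1 w : `|dot x w| <= hnorm w.
  apply: le_trans (dot_CauchySchwarz x w) _.
  by rewrite ler_piMl ?sqrtr_ge0.
rewrite adjointP.
have xE : x = \sum_(i < n) coord b i x *: b`_i.
  by apply: coord_vbasis; rewrite memvf.
rewrite [in adjoint T _]xE !linear_sum /=.
apply: ler_sum => i _; rewrite !linearZ /= zE comp_lfunE.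
apply: le_trans (ler_norm _) _; rewrite normrM.
by apply: ler_pM.
Qed.

End Operators.

(* Main.v *)
(* For Z in S the hypotheses give, for every vector u,
     sum_j |Z W_j u - W_j Z u|^2 = sum_j |Z W_j u|^2 - |Z u|^2.
   Let K be a minimal nonzero subspace invariant under all W_j. If a product A
   of elements of S commutes with the W_j on K, then on the top eigenspace in K
   of the quadratic form v |-> |Z A v|^2 the right-hand side (for u = A v) is
   nonpositive, so it vanishes and this eigenspace is W_j-invariant; by
   minimality it is K, and Z A commutes with the W_j on K too. The vectors on
   which all products of elements of S commute with the W_j thus form a nonzero
   S-invariant subspace, which is H by irreducibility. Since S is self-adjoint,
   S lies in the real C*-algebra of operators commuting with W_j and W_j^*. *)

Require Import Defs.
From HB Require Import structures.
From mathcomp Require Import all_boot all_order all_algebra.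
From mathcomp Require Import boolp classical_sets reals.
From mathcomp Require Import ring lra.

Set Implicit Arguments.
Unset Strict Implicit.
Unset Printing Implicit Defensive.

Import Order.TTheory GRing.Theory Num.Theory.

Local Open Scope classical_set_scope.
Local Open Scope ring_scope.

(** * Subspaces cut out by predicates and minimal invariant subspaces *)

(** Take a subspace of maximal dimension inside [P]: adjoining a vector of [P] stays inside [P], so
    that vector was already in it. *)
Lemma vspace_of_pred (F : fieldType) (V : vectType F) (P : V -> Prop) :
    P 0 -> (forall a u v, P u -> P v -> P (a *: u + v)) ->
  exists U : {vspace V}, forall v, v \in U <-> P v.
Proof.
move=> P0 Plin.
pose Q n := `[< exists U : {vspace V}, (forall v, v \in U -> P v) /\ \dim U = n >].
have exQ : exists n, Q n.
  exists 0%N; apply/asboolP; exists 0%VS; split; last exact: dimv0.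
  by move=> v; rewrite memv0 => /eqP->.
have leQ n : Q n -> (n <= \dim (@fullv _ V))%N.
  by move=> /asboolP[U [_ <-]]; apply/dimvS/subvf.
case: (ex_maxnP exQ leQ) => _ /asboolP[U [UP <-]] Umax.
exists U => v; split; first exact: UP.
move=> Pv; have /eqP-> : U == (U + <[v]>)%VS.
  rewrite eqEdim addvSl; apply: Umax; apply/asboolP; eexists; split=> // w.
  by case/memv_addP=> u Uu [_ /vlineP[a ->] ->]; rewrite addrC; apply/Plin/UP.
by rewrite (subvP (addvSr U <[v]>)) ?memv_line.
Qed.

Lemma minimal_invariant (F : fieldType) (V : vectType F) (I : Type)
    (W : I -> 'End(V)) : fullv != 0%VS :> {vspace V} ->
  exists K : {vspace V}, [/\ K != 0%VS, forall j, (W j @: K <= K)%VS &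
    forall E : {vspace V}, E != 0%VS -> (E <= K)%VS ->
      (forall j, (W j @: E <= E)%VS) -> E = K].
Proof.
move=> V0.
pose Q n := `[< exists U : {vspace V}, [/\ U != 0%VS,
  forall j, (W j @: U <= U)%VS & \dim U = n] >].
have exQ : exists n, Q n.
  exists (\dim (@fullv _ V)); apply/asboolP; exists fullv; split=> // j.
  exact: subvf.
case: (ex_minnP exQ) => _ /asboolP[K [K0 KW <-]] Kmin.
exists K; split=> // E E0 EK EW; apply/eqP; rewrite eqEdim EK.
by apply: Kmin; apply/asboolP; exists E.
Qed.

(** * The inner product induced on a subspace *)

Section SubspaceDot.
Variables (R : realType) (H : vectType R) (dot : {dot H for idfun}).
Variable K : {vspace H}.

(** Makes [K] a Hilbert space in its own right, so that results about whole spaces apply to it. *)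
Definition subdot (x y : subvs_of K) : R := dot (vsval x) (vsval y).

Lemma subdot_bilinear : bilinear_for *%R (idfun \; *%R) subdot.
Proof.
by split=> [x a y z|x a y z]; rewrite /subdot linearP ?linearPr ?linearPl.
Qed.
HB.instance Definition _ := bilinear_isBilinear.Build R (subvs_of K) (subvs_of K)
  R *%R (idfun \; *%R) subdot subdot_bilinear.

Lemma subdot_hermitian x y : subdot x y = (-1) ^+ false * idfun (subdot y x).
Proof. by rewrite /subdot hermC. Qed.
HB.instance Definition _ := isHermitianSesquilinear.Build R (subvs_of K) false
  idfun subdot subdot_hermitian.

Lemma subdot_gt0 x : x != 0 -> 0 < subdot x x.
Proof. by move=> x0; apply: dot_gt0; rewrite (inj_eq val_inj x 0). Qed.
HB.instance Definition _ := isDotProduct.Build R (subvs_of K)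
  subdot subdot_gt0.

End SubspaceDot.

(** * The largest eigenvalue of a symmetric operator *)

Section Operators.
Variables (R : realType) (H : vectType R) (dot : {dot H for idfun}).
Implicit Types (T Q : 'End(H)) (x y v : H).

Lemma quadform_bounded T :
  exists2 M : R, 0 < M & forall x, dot x x = 1 -> dot (T x) x <= M.
Proof.
have [_ [M MT]] := opnorm_has_sup dot T.
(* The maximum with 1 makes the bound positive, hence invertible. *)
exists (Num.max M 1) => [|x x1]; first by rewrite lt_max ltr01 orbT.
apply: le_trans (ler_norm _) _; apply: le_trans (dot_CauchySchwarz _ _ _) _.
have hx : hnorm dot x = 1 by rewrite /hnorm x1 sqrtr1.
by rewrite hx mulr1 le_max MT //; exists x => //=; rewrite hx.
Qed.

(** If [Q v] were nonzero, a short move from [v] along [- Q v] would make the form negative: its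
    value at [v - t *: Q v] is [- 2 t a + t^2 b]. *)
Lemma psd_kernel Q v : (forall x y, dot (Q x) y = dot x (Q y)) ->
  (forall x, 0 <= dot (Q x) x) -> dot (Q v) v = 0 -> Q v = 0.
Proof.
move=> Qsym Qpsd Qv0; apply/(@dot_eq0 _ _ dot)/eqP.
rewrite eq_le dot_ge0 andbT leNgt.
apply/negP => a0; set a := dot (Q v) (Q v) in a0.
set b := dot (Q (Q v)) (Q v); have b0 : 0 <= b := Qpsd _.
(* This choice gives [t b < a], and its denominator is positive even if [b = 0]. *)
pose t := a / (a + b).
have := Qpsd (v - t *: Q v).
rewrite [Q (_ - _)]linearB /= [Q (_ *: _)]linearZ /=.
rewrite linearBl !linearBr !linearZl_LR !linearZr_LR /=.
rewrite Qv0 [dot (Q (Q v)) v]Qsym -/a -/b => h.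
have ab : a + b != 0 by rewrite gt_eqF// ltr_pwDl.
have tb : t * (a + b) = a by rewrite divfK.
have t0 : 0 < t by rewrite divr_gt0 // ltr_pwDl.
by nra.
Qed.

(** Take for [l] the supremum of the form on the unit sphere. Were [l - Q] injective, it would be
    invertible, and the form would stay below [l] by a fixed margin. *)
Lemma top_eigenvector Q : (forall x y, dot (Q x) y = dot x (Q y)) ->
    fullv != 0%VS :> {vspace H} ->
  exists2 l : R, forall x, dot (Q x) x <= l * dot x x &
    exists2 v, v != 0 & Q v = l *: v.
Proof.
move=> Qsym H0.
have unit x : x != 0 -> exists2 c, 0 < c & c ^+ 2 * dot x x = 1.
  move=> /(dot_gt0 dot) x0; exists (Num.sqrt (dot x x))^-1.
    by rewrite invr_gt0 sqrtr_gt0.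
  by rewrite exprVn sqr_sqrtr ?ltW// mulVf// gt_eqF.
have dotZ (T : 'End(H)) c x : dot (T (c *: x)) (c *: x) = c ^+ 2 * dot (T x) x.
  by rewrite [T _]linearZ /= linearZl_LR linearZr_LR /=; ring.
have dotZ1 c x : dot (c *: x) (c *: x) = c ^+ 2 * dot x x.
  by rewrite linearZl_LR linearZr_LR /=; ring.
pose E := [set dot (Q x) x | x in [set x | dot x x = 1]].
have supE : has_sup E.
  split; last by have [M _ MQ] := quadform_bounded Q; exists M => _ [x /= /MQ + <-].
  have /unit[c _ c1] : vpick (@fullv _ H) != 0 by rewrite vpick0.
  by eexists; exists (c *: vpick fullv) => //=; rewrite dotZ1.
pose l := sup E; exists l.
  move=> x; have [->|x0] := eqVneq x 0; first by rewrite !linear0r mulr0.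
  have [c c0 c1] := unit x x0.
  have : dot (Q (c *: x)) (c *: x) <= l.
    by apply: sup_upper_bound => //; exists (c *: x) => //=; rewrite dotZ1.
  rewrite dotZ => /(ler_wpM2r (dot_ge0 dot x)).
  by rewrite mulrAC c1 mul1r.
pose B := (l *: \1 - Q)%VF.
have BE x : B x = l *: x - Q x by rewrite add_lfunE opp_lfunE scale_lfunE id_lfunE.
have [kerB|kerB] := boolP (lker B == 0%VS); last first.
  exists (vpick (lker B)); first by rewrite vpick0.
  have := memv_pick (lker B); rewrite memv_ker BE subr_eq0 => /eqP<-//.
have Bsym x y : dot (B x) y = dot x (B y).
  by rewrite !BE linearBl linearBr /= linearZl_LR linearZr_LR Qsym.
have Bpsd x : 0 <= dot (B x) x.
  have [->|x0] := eqVneq x 0; first by rewrite linear0r.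
  have [c c0 c1] := unit x x0.
  rewrite -(pmulr_rge0 _ (exprn_gt0 2 c0)) -dotZ BE linearBl /= linearZl_LR /=.
  rewrite dotZ1 c1 mulr1 subr_ge0; apply: sup_upper_bound => //.
  by exists (c *: x) => //=; rewrite dotZ1.
have [M M0 MB] := quadform_bounded (B^-1)%VF.
(* An invertible positive B is bounded below by 1/M on the unit sphere, where
   M bounds B^-1: expand 0 <= (B(x - t y), x - t y) for B y = x and t = 1/M. *)
have lowB x : dot x x = 1 -> M^-1 <= dot (B x) x.
  move=> x1; pose y := (B^-1)%VF x.
  have By : B y = x by exact: lker0_lfunVK.
  have := Bpsd (x - M^-1 *: y).
  rewrite [B (_ - _)]linearB /= [B (_ *: _)]linearZ /= By.
  rewrite linearBl !linearBr !linearZl_LR !linearZr_LR /=.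
  rewrite [dot (B x) y]Bsym By x1 (dot_sym _ x y) => h.
  have := MB _ x1; rewrite -/y => yx.
  have : M^-1 * (M^-1 * dot y x) <= M^-1.
    apply: ler_piMr; first by rewrite invr_ge0 ltW.
    by rewrite ler_pdivrMl ?mulr1.
  by lra.
have : l <= l - M^-1.
  apply: ge_sup; first by case: supE.
  move=> _ [x /= x1 <-]; have := lowB x x1.
  by rewrite BE linearBl /= linearZl_LR /= x1; lra.
have : 0 < M^-1 by rewrite invr_gt0.
by lra.
Qed.

End Operators.

(** * Top eigenspaces and the commutator identity *)

Section Commutation.
Variables (R : realType) (H : vectType R) (dot : {dot H for idfun}).
Implicit Types (T U V Z A : 'End(H)) (x y v : H).

(** Since [T] may map [K] outside itself, [Q] is the compression of [T^* T] to [K], obtained by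
    Riesz representation, and [E] is its top eigenspace. *)
Lemma top_eigenspace (K : {vspace H}) T : K != 0%VS ->
  exists l : R, exists E : {vspace H}, [/\ E != 0%VS, (E <= K)%VS,
    forall v, v \in K -> dot (T v) (T v) <= l * dot v v &
    forall v, v \in K -> v \in E <-> dot (T v) (T v) = l * dot v v].
Proof.
move=> K0; pose d : {dot subvs_of K for idfun} := @subdot _ _ dot K.
have dE (x y : subvs_of K) : d x y = dot (vsval x) (vsval y) by [].
have /boolp.choice[h hE] : forall y : subvs_of K, exists z, forall x : subvs_of K,
    dot (T (vsval x)) (T (vsval y)) = d x z.
  move=> y; apply: (@riesz _ _ d
    (fun x : subvs_of K => dot (T (vsval x)) (T (vsval y)))).
  by move=> a u v; rewrite !linearP linearPl.
have h_lin : linear h.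
  move=> a u v; apply: (dot_inj (dot := d)) => z; by rewrite -hE !linearP /= !hE.
pose h' : {linear subvs_of K -> subvs_of K} :=
  HB.pack h (GRing.isLinear.Build _ _ _ _ h h_lin).
pose Q := linfun h'.
have QE (x y : subvs_of K) : d x (Q y) = dot (T (vsval x)) (T (vsval y)).
  by rewrite lfunE /= hE.
have Qsym (x y : subvs_of K) : d (Q x) y = d x (Q y) by rewrite dot_sym !QE dot_sym.
have K0' : fullv != 0%VS :> {vspace subvs_of K}.
  by rewrite -dimv_eq0 dimvf /dim /= dimv_eq0.
have [l Ql [e e0 Qe]] := top_eigenvector Qsym K0'.
have [E EP] : exists E : {vspace H}, forall v, v \in E <->
    v \in K /\ Q (vsproj K v) = l *: vsproj K v.
  apply: vspace_of_pred => [|a u v [uK uE] [vK vE]].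
    by rewrite mem0v !linear0.
  rewrite rpredD ?rpredZ//; split=> //;
  by rewrite !linearP /= uE vE.
exists l, E; split.
- apply: contraNneq e0 => E0; apply/eqP/val_inj/eqP; rewrite -memv0 -E0.
  by apply/EP; rewrite vsvalK; split; first exact: subvsP.
- by apply/subvP => v /EP[].
- by move=> v vK; have := Ql (vsproj K v); rewrite Qsym QE dE vsprojK.
move=> v vK; split=> [/EP[_ Qv]|Qv].
  have := QE (vsproj K v) (vsproj K v).
  by rewrite Qv linearZr_LR /= dE !vsprojK.
apply/EP; split=> //; apply/esym/eqP; rewrite -subr_eq0; apply/eqP.
(* [B] is positive and its form vanishes at [v], so [B] kills [v]. *)
pose B := (l *: \1 - Q)%VF.
have BE (x : subvs_of K) : B x = l *: x - Q x.
  by rewrite add_lfunE opp_lfunE scale_lfunE id_lfunE.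
rewrite -BE; apply: (@psd_kernel _ _ d) => [x y|x|].
- by rewrite !BE linearBl linearBr /= linearZl_LR linearZr_LR Qsym.
- by rewrite BE linearBl /= linearZl_LR subr_ge0 Ql.
by rewrite BE linearBl /= linearZl_LR Qsym QE /= /subdot !vsprojK // Qv subrr.
Qed.

Lemma sum_dot_partition (n : nat) (W : 'I_n -> 'End(H)) x :
    \sum_(j < n) (adjoint dot (W j) \o W j)%VF = \1%VF ->
  \sum_(j < n) dot (W j x) (W j x) = dot x x.
Proof.
move=> W1; under eq_bigr do rewrite adjointP -comp_lfunE.
by rewrite -linear_sumr -sum_lfunE W1 id_lfunE.
Qed.

(** Expand the squares: the terms [|W_j T x|^2] sum to [|T x|^2], and so do the cross terms, which
    enter with factor -2. *)
Lemma sum_commutator (n : nat) (W : 'I_n -> 'End(H)) T x :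
    \sum_(j < n) (adjoint dot (W j) \o W j)%VF = \1%VF ->
    \sum_(j < n) (adjoint dot (W j) \o T \o W j)%VF = T ->
  \sum_(j < n) dot (T (W j x) - W j (T x)) (T (W j x) - W j (T x)) =
  \sum_(j < n) dot (T (W j x)) (T (W j x)) - dot (T x) (T x).
Proof.
move=> W1 WT.
have cross : \sum_(j < n) dot (W j (T x)) (T (W j x)) = dot (T x) (T x).
  under eq_bigr do rewrite adjointP -!comp_lfunE.
  by rewrite -linear_sumr -sum_lfunE WT.
under eq_bigr => j _ do rewrite linearBl !linearBr /= [dot (T _) (W _ _)]dot_sym.
by rewrite !sumrB sum_dot_partition // cross; ring.
Qed.

(** * Products of elements of [S] and their commutation with the [W j] *)

Inductive word (S : set 'End(H)) : 'End(H) -> Prop :=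
| word_id : word S \1%VF
| word_cons Z A : S Z -> word S A -> word S (Z \o A)%VF.

Lemma word_rcons (S : set 'End(H)) Z A : word S A -> S Z -> word S (A \o Z)%VF.
Proof.
move=> wA SZ; elim: wA => [|Z' A' SZ' _ IH].
  by rewrite comp_lfun1l -[Z]comp_lfun1r; apply: word_cons => //; apply: word_id.
by rewrite -comp_lfunA; apply: word_cons.
Qed.

Lemma word_commute_minimal (n : nat) (W : 'I_n -> 'End(H)) (S : set 'End(H))
    (K : {vspace H}) :
    \sum_(j < n) (adjoint dot (W j) \o W j)%VF = \1%VF ->
    (forall Z, S Z -> \sum_(j < n) (adjoint dot (W j) \o Z \o W j)%VF = Z) ->
    K != 0%VS -> (forall j, (W j @: K <= K)%VS) ->
    (forall E : {vspace H}, E != 0%VS -> (E <= K)%VS ->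
       (forall j, (W j @: E <= E)%VS) -> E = K) ->
  forall A, word S A -> forall j v, v \in K -> A (W j v) = W j (A v).
Proof.
move=> W1 WS K0 KW Kmin A; elim=> [|Z {}A SZ _ IH] j0 v0 v0K.
  by rewrite !id_lfunE.
have WK j v : v \in K -> W j v \in K.
  by move=> vK; apply: (subvP (KW j)); apply: memv_img.
pose T := (Z \o A)%VF.
(* [T] itself need not be fixed by the averaging. The induction hypothesis moves [A] past [W j],
   which reduces to [sum_commutator] for [Z] at [A v]. *)
have defect v : v \in K ->
    \sum_j dot (T (W j v) - W j (T v)) (T (W j v) - W j (T v)) =
    \sum_j dot (T (W j v)) (T (W j v)) - dot (T v) (T v).
  move=> vK; have TE u : T u = Z (A u) by rewrite comp_lfunE.
  under eq_bigr do rewrite !TE IH //.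
  rewrite sum_commutator ?WS // TE; congr (_ - _).
  by apply: eq_bigr => j _; rewrite TE IH.
have [l [E [E0 EK Tl EP]]] := top_eigenspace T K0.
(* On the top eigenspace E of v |-> |T v|^2 the averages over the W j cannot
   exceed the maximum l, while [defect] says that they cannot decrease. *)
have {E0} EE : E = K.
  apply: Kmin => // j; apply/subvP => _ /memv_imgP[v vE ->].
  have vK : v \in K := subvP EK _ vE.
  (* The gaps [b i] are nonnegative and their sum is minus a sum of squares, so all vanish. *)
  pose b i := l * dot (W i v) (W i v) - dot (T (W i v)) (T (W i v)).
  have b0 i : true -> 0 <= b i by move=> _; rewrite subr_ge0 Tl ?WK.
  have sb : \sum_i b i = 0.
    apply/eqP; rewrite eq_le sumr_ge0 // andbT sumrB -mulr_sumr.
    rewrite sum_dot_partition // -(EP v vK).1 // -opprB oppr_le0 -defect //.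
    by apply: sumr_ge0 => i _; apply: dot_ge0.
  apply/EP; first exact: WK.
  have /eqP : b j = 0 by exact: (psumr_eq0P b0 sb).
  by rewrite subr_eq0 => /eqP.
have Tn v : v \in K -> dot (T v) (T v) = l * dot v v.
  by move=> vK; apply/EP => //; rewrite EE.
(* Now the right-hand side is [l |v0|^2 - l |v0|^2 = 0], so each commutator vanishes at [v0]. *)
have := defect _ v0K; rewrite Tn //.
under [X in _ = X - _]eq_bigr do rewrite Tn ?WK//.
rewrite -mulr_sumr sum_dot_partition // subrr => /psumr_eq0P h.
apply/eqP; rewrite -subr_eq0; apply/eqP/(@dot_eq0 _ _ dot)/h => // i _.
exact: dot_ge0.
Qed.

Lemma irreducible_commute (n : nat) (W : 'I_n -> 'End(H)) (S : set 'End(H)) :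
    irreducible_family S ->
    \sum_(j < n) (adjoint dot (W j) \o W j)%VF = \1%VF ->
    (forall Z, S Z -> \sum_(j < n) (adjoint dot (W j) \o Z \o W j)%VF = Z) ->
  forall j Z, S Z -> (W j \o Z)%VF = (Z \o W j)%VF.
Proof.
move=> Sirr W1 WS j0 Z0 SZ0.
have [H0|H0] := eqVneq (@fullv _ H) 0%VS.
  have x0 x : x = 0 by apply/eqP; rewrite -memv0 -H0 memvf.
  by apply/lfunP => x; rewrite [LHS]x0 [RHS]x0.
have [K [K0 KW Kmin]] := minimal_invariant W H0.
have comm := word_commute_minimal W1 WS K0 KW Kmin.
have [U UP] : exists U : {vspace H}, forall v, v \in U <->
    forall A, word S A -> forall j, A (W j v) = W j (A v).
  apply: vspace_of_pred => [A _ j|a u v uP vP A wA j]; first by rewrite !linear0.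
  by rewrite !linearP /= uP // vP.
have [U0|UT] : U = 0%VS \/ U = fullv.
  apply: Sirr => Z SZ; apply/subvP => _ /memv_imgP[v /UP vU ->].
  (* The words [Z] and [A Z] give [A W_j Z v = A Z W_j v = W_j A Z v]. *)
  apply/UP => A wA j; have wAZ := word_rcons wA SZ.
  have wZ : word S Z.
    by rewrite -[Z]comp_lfun1r; apply: word_cons => //; apply: word_id.
  by have := vU _ wAZ j; rewrite !comp_lfunE (vU _ wZ).
  (* [U] contains the nonzero space [K]. *)
  case/negP: K0; rewrite -subv0 -U0; apply/subvP => v vK; apply/UP => A wA j.
  exact: comm.
apply/lfunP => x; rewrite !comp_lfunE; apply/esym.
have /UP : x \in U by rewrite UT memvf.
by apply; rewrite -[Z0]comp_lfun1r; apply: word_cons => //; apply: word_id.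
Qed.

(** * Commutants as real C*-algebras *)

Lemma adjointK T : adjoint dot (adjoint dot T) = T.
Proof.
by apply/esym/adjoint_unique => x y; rewrite dot_sym -adjointP dot_sym.
Qed.

Lemma adjoint_comp T U :
  adjoint dot (T \o U)%VF = (adjoint dot U \o adjoint dot T)%VF.
Proof.
by apply/esym/adjoint_unique => x y; rewrite !comp_lfunE -!adjointP.
Qed.

Lemma dot_opnorm T x y :
  `|dot (T x) y| <= opnorm dot T * (hnorm dot x * hnorm dot y).
Proof.
have [->|x0] := eqVneq x 0.
  rewrite linear0 linear0l normr0 /hnorm linear0l sqrtr0 mul0r mulr0//.
have hx : 0 < hnorm dot x by rewrite sqrtr_gt0 dot_gt0.
have hZ (c : R) z : 0 <= c -> hnorm dot (c *: z) = c * hnorm dot z.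
  move=> c0; rewrite /hnorm linearZl_LR linearZr_LR /= mulrA -expr2.
  rewrite sqrtrM ?sqr_ge0//.
  by rewrite sqrtr_sqr ger0_norm.
apply: le_trans (dot_CauchySchwarz _ _ _) _.
rewrite mulrA ler_wpM2r ?sqrtr_ge0// -ler_pdivrMr//.
have hi : 0 <= (hnorm dot x)^-1 by rewrite invr_ge0 ltW.
rewrite mulrC -hZ // -linearZ.
apply: sup_upper_bound; first exact: opnorm_has_sup.
by exists ((hnorm dot x)^-1 *: x) => //=; rewrite hZ // mulVf// gt_eqF.
Qed.

(** For [U] commuting with [V], the entry of [V T - T V] at [x], [y] depends only on [T - U], and is
    at most [c] times its norm. *)
Lemma commute_norm_closed V :
  norm_closed dot [set T | (V \o T)%VF = (T \o V)%VF].
Proof.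
move=> T Tlim; apply/lfunP => x; apply: (dot_inj (dot := dot)) => y.
rewrite !comp_lfunE !(dot_sym _ y).
set c := hnorm dot x * hnorm dot (adjoint dot V y) + hnorm dot (V x) * hnorm dot y.
apply/eqP; rewrite -subr_eq0 -normr_le0; apply/ler_addgt0Pr => e e0.
have c0 : 0 <= c by rewrite addr_ge0 // mulr_ge0 ?sqrtr_ge0.
have c1 : 0 < c + 1 by rewrite ltr_pwDr.
(* Dividing by [c + 1] covers the case [c = 0]. *)
have [U VU TU] := Tlim (e / (c + 1)) (divr_gt0 e0 c1).
have -> : dot (V (T x)) y - dot (T (V x)) y =
    dot ((T - U)%VF x) (adjoint dot V y) - dot ((T - U)%VF (V x)) y.
  have := congr1 (fun F : 'End(H) => F x) VU; rewrite !comp_lfunE => VUx.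
  by rewrite -adjointP !add_lfunE !opp_lfunE linearB /= VUx !linearBl /=; ring.
apply: le_trans (ler_normB _ _) _.
apply: le_trans (lerD (dot_opnorm _ _ _) (dot_opnorm _ _ _)) _.
rewrite -mulrDr -/c add0r.
apply: le_trans (ler_wpM2r c0 (ltW TU)) _.
by rewrite mulrAC ler_pdivrMr // ler_pM2l // lerDl.
Qed.

(** Taking adjoints exchanges the two identities, whence closure under [adjoint]. *)
Lemma commutant_Cstar V : is_real_Cstar_algebra dot
  [set T | (V \o T)%VF = (T \o V)%VF /\
           (adjoint dot V \o T)%VF = (T \o adjoint dot V)%VF].
Proof.
split=> /=.
- by rewrite !comp_lfun0l !comp_lfun0r.
- move=> a T U [T1 T2] [U1 U2].
  by rewrite !comp_lfunDr !comp_lfunDl -!comp_lfunZr -!comp_lfunZl T1 T2 U1 U2.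
- move=> T U [T1 T2] [U1 U2].
  by rewrite !comp_lfunA T1 T2 -!comp_lfunA U1 U2.
- move=> T [T1 T2]; split; last by rewrite -!adjoint_comp T1.
  by rewrite -[V]adjointK -!adjoint_comp T2.
- move=> T Tlim; split; apply: commute_norm_closed => e e0;
  by have [U [U1 U2] TU] := Tlim e e0; exists U.
Qed.

End Commutation.

(** * Passage from [S] to the generated algebra *)

Theorem proposition3p17 (R : realType) (H : vectType R) (dot : {dot H for idfun})
    (S : set 'End(H)) (W : 'I_2 -> 'End(H))
    (S_irr : irreducible_family S) (S_sa : selfadjoint_family dot S)
    (W_fix : forall Z, S Z ->
       \sum_(j < 2) (adjoint dot (W j) \o Z \o W j)%VF = Z)
    (W_unit : \sum_(j < 2) (adjoint dot (W j) \o W j)%VF = \1%VF) :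
  forall (j : 'I_2) (Z : 'End(H)), Cstar dot S Z -> (W j \o Z)%VF = (Z \o W j)%VF.
Proof.
move=> j Z CZ.
have comm := irreducible_commute S_irr W_unit W_fix.
pose C := [set T : 'End(H) | (W j \o T)%VF = (T \o W j)%VF /\
  (adjoint dot (W j) \o T)%VF = (T \o adjoint dot (W j))%VF].
suff SC : S `<=` C by have [] := CZ C (conj (commutant_Cstar dot (W j)) SC).
move=> T ST; split; first exact: comm.
(* Write [T = U^*] with [U] in [S] and take adjoints in [W_j U = U W_j]. *)
have : S T := ST; rewrite S_sa => -[U SU <-].
by rewrite -!adjoint_comp comm.
Qed.
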